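(* Let $G$ be a Lie group with Lie algebra $\mathfrak g$ and let $E=E(\xi,\nu)$ be a Lagrangian on $\mathfrak g_2\circledS\mathfrak g_3^*$, the Lie algebra of $G\circledS\mathfrak g^*$. The Euler-Poincaré equations on the Lie algebra $\mathfrak g_2\circledS\mathfrak g_3^*$ are $$\frac{d}{dt}\Big(\frac{\delta E}{\delta\xi}\Big)=\mathrm{ad}^*_\xi\Big(\frac{\delta E}{\delta\xi}\Big)-\mathrm{ad}^*_{\frac{\delta E}{\delta\nu}}\nu,\qquad\frac{d}{dt}\Big(\frac{\delta E}{\delta\nu}\Big)=-\mathrm{ad}_\xi\frac{\delta E}{\delta\nu}.$$
   Context: $G$ is a (finite-dimensional) Lie group, $\mathfrak g=T_eG$; $\mathfrak g_2,\mathfrak g_3^*$ are copies of $\mathfrak g,\mathfrak g^*$. In this statement the bracket $\mathrm{ad}_\xi\eta=[\xi,\eta]$ on $\mathfrak g$ is the one determined by right invariant vector fields: if $X_\xi(g)=T_eR_g\xi$ ($R_g$ right multiplication), then $[X_\xi,X_\eta]_{JL}=X_{[\xi,\eta]}$ (Jacobi-Lie bracket of vector fields). $\mathrm{ad}^*_\xi$ is the linear dual: $\langle\mathrm{ad}^*_\xi\mu,\eta\rangle=\langle\mu,[\xi,\eta]\rangle$. The Lie algebra $\mathfrak g\circledS\mathfrak g^*$ has bracket $[(\xi,\nu),(\eta,\lambda)]=([\xi,\eta],\mathrm{ad}^*_\eta\nu-\mathrm{ad}^*_\xi\lambda)$. The Euler-Poincaré equations are the conditions for extremals of $\int_a^bE(\xi,\nu)\,dt$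 under the reduced variations $\delta(\xi,\nu)=\frac{d}{dt}(\eta,\lambda)+[(\xi,\nu),(\eta,\lambda)]$, with $(\eta,\lambda)$ an arbitrary curve in $\mathfrak g\circledS\mathfrak g^*$ vanishing at the end points. $\frac{\delta E}{\delta\xi}\in\mathfrak g^*$, $\frac{\delta E}{\delta\nu}\in\mathfrak g$ are partial derivatives. *)

(* Defs.v *)
From HB Require Import structures.
From mathcomp Require Import all_boot all_order all_algebra.
From mathcomp Require Import all_classical all_reals all_analysis.

Set Implicit Arguments.
Unset Strict Implicit.
Unset Printing Implicit Defensive.

Import Order.TTheory GRing.Theory Num.Theory.
Import numFieldNormedType.Exports.

Local Open Scope classical_set_scope.
Local Open Scope ring_scope.

(** * Smooth maps *)

(* [Ck_on k O f], for [O] open and a finite-dimensional domain, says that [f]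
   is of class C^k on [O]: in finite dimension the derivative of [f] is C^k
   iff all the directional derivatives ['D_v f] are. *)
Fixpoint Ck_on {R : realType} (k : nat) {U V : normedModType R}
    (O : set U) (f : U -> V) : Prop :=
  match k with
  | 0 => forall x, O x -> {for x, continuous f}
  | k'.+1 => (forall x, O x -> differentiable f x) /\
             forall v : U, Ck_on k' O ('D_v f)
  end.

(* For an arbitrary set [A], smooth on [A] means C^oo on an open neighbourhood
   of [A]; in particular the derivatives at boundary points of [A] make
   sense. *)
Definition smooth_on {R : realType} {U V : normedModType R}
    (A : set U) (f : U -> V) : Prop :=
  exists O : set U, [/\ open O, A `<=` O & forall k, Ck_on k O f].

(** * Lie groups *)

(* [chart_map] and [chart_inv] are total functions that are only meaningful on
   [chart_dom] and [chart_img] respectively. *)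
Record chart (R : realType) (T : topologicalType) (V : normedModType R) :=
  Chart {
    chart_dom : set T;
    chart_img : set V;
    chart_map :> T -> V;
    chart_inv : V -> T;
    chart_dom_open : open chart_dom;
    chart_img_open : open chart_img;
    chart_map_img : forall g, chart_dom g -> chart_img (chart_map g);
    chart_inv_dom : forall x, chart_img x -> chart_dom (chart_inv x);
    chart_mapK : forall g, chart_dom g -> chart_inv (chart_map g) = g;
    chart_invK : forall x, chart_img x -> chart_map (chart_inv x) = x;
    chart_map_continuous :
      forall g, chart_dom g -> {for g, continuous chart_map};
    chart_inv_continuous :
      forall x, chart_img x -> {for x, continuous chart_inv}
  }.

#[short(type="topGroupType")]
HB.structure Definition TopGroup := {T of Topological T & Group T}.

(* A map between manifolds is smooth if it is continuous and smooth in charts;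
   continuity makes the domains of the coordinate expressions open. *)
Record lieGroup (R : realType) (n : nat) := LieGroup {
  lie_car :> topGroupType;
  lie_hausdorff : hausdorff_space lie_car;
  lie_second_countable : @second_countable lie_car;
  lie_atlas : set (chart lie_car 'rV[R]_n);
  lie_atlas_cover :
    forall g : lie_car, exists2 c, lie_atlas c & chart_dom c g;
  lie_atlas_smooth : forall c c', lie_atlas c -> lie_atlas c' ->
    smooth_on [set x | chart_img c x /\ chart_dom c' (chart_inv c x)]
      (fun x => c' (chart_inv c x));
  lie_mul_continuous :
    continuous (fun p : lie_car * lie_car => (p.1 * p.2)%g);
  lie_mul_smooth : forall c1 c2 c3,
    lie_atlas c1 -> lie_atlas c2 -> lie_atlas c3 ->
    smooth_on [set p : 'rV[R]_n * 'rV[R]_n |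
                 [/\ chart_img c1 p.1, chart_img c2 p.2
                   & chart_dom c3 (chart_inv c1 p.1 * chart_inv c2 p.2)%g]]
      (fun p => c3 (chart_inv c1 p.1 * chart_inv c2 p.2)%g);
  lie_inv_continuous : continuous (fun g : lie_car => (g^-1)%g);
  lie_inv_smooth : forall c1 c2, lie_atlas c1 -> lie_atlas c2 ->
    smooth_on [set x | chart_img c1 x /\ chart_dom c2 ((chart_inv c1 x)^-1)%g]
      (fun x => c2 ((chart_inv c1 x)^-1)%g)
}.

(** * The Lie algebra *)

(* A chart [c] of the atlas around the unit identifies g = T_eG with
   ['rV[R]_n], so that [lie_bracket c] is the Lie bracket of g read in [c]. *)

(* The Jacobi-Lie bracket of vector fields: [X, Y] = DY.X - DX.Y. *)
Definition jacobi_lie {R : realType} {V : normedModType R}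
    (X Y : V -> V) (x : V) : V :=
  'D_(X x) Y x - 'D_(Y x) X x.

(* The right invariant vector field X_xi(g) = T_eR_g xi. *)
Definition right_invariant_field {R : realType} {n : nat} {G : lieGroup R n}
    (c : chart G 'rV[R]_n) (xi : 'rV[R]_n) (y : 'rV[R]_n) : 'rV[R]_n :=
  'D_xi (fun x => c (chart_inv c x * chart_inv c y)%g) (c 1%g).

(* As X_zeta(e) = zeta, the relation [X_xi, X_eta] = X_[xi, eta] amounts to
   defining [xi, eta] as the value of the left-hand side at e. *)
Definition lie_bracket {R : realType} {n : nat} {G : lieGroup R n}
    (c : chart G 'rV[R]_n) (xi eta : 'rV[R]_n) : 'rV[R]_n :=
  jacobi_lie (right_invariant_field c xi) (right_invariant_field c eta)
    (c 1%g).

(* The dual g^* is ['cV[R]_n]. *)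
Definition pairing {R : realType} {n : nat}
    (mu : 'cV[R]_n) (eta : 'rV[R]_n) : R := (eta *m mu) 0 0.

(* The element of g^* given by a linear functional on g. *)
Definition covector_of {R : realType} {n : nat} (l : 'rV[R]_n -> R) :
  'cV[R]_n := \col_i l (delta_mx 0 i).

(* The element of g given by a linear functional on g^*. *)
Definition vector_of {R : realType} {n : nat} (l : 'cV[R]_n -> R) :
  'rV[R]_n := \row_i l (delta_mx i 0).

Lemma covector_ofE (R : realType) (n : nat) (l : {scalar 'rV[R]_n})
  (eta : 'rV[R]_n) : pairing (covector_of l) eta = l eta.
Proof.
rewrite /pairing mxE {2}(row_sum_delta eta) linear_sum /=.
by apply: eq_bigr => i _; rewrite mxE linearZ.
Qed.

Lemma vector_ofE (R : realType) (n : nat) (l : {scalar 'cV[R]_n})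
  (mu : 'cV[R]_n) : pairing mu (vector_of l) = l mu.
Proof.
rewrite /pairing mxE {2}(matrix_sum_delta mu) linear_sum /=.
by apply: eq_bigr => i _; rewrite big_ord1 linearZ !mxE mulrC.
Qed.

Definition coad {R : realType} {n : nat} {G : lieGroup R n}
    (c : chart G 'rV[R]_n) (xi : 'rV[R]_n) (mu : 'cV[R]_n) : 'cV[R]_n :=
  covector_of (fun eta => pairing mu (lie_bracket c xi eta)).

Definition semidirect_bracket {R : realType} {n : nat} {G : lieGroup R n}
    (c : chart G 'rV[R]_n) (p q : 'rV[R]_n * 'cV[R]_n) : 'rV[R]_n * 'cV[R]_n :=
  (lie_bracket c p.1 q.1, coad c q.1 p.2 - coad c p.1 q.2).

(** * The reduced variational principle *)

Definition dE_dxi {R : realType} {n : nat} (E : 'rV[R]_n * 'cV[R]_n -> R)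
    (p : 'rV[R]_n * 'cV[R]_n) : 'cV[R]_n :=
  covector_of (fun eta => 'D_(eta, 0) E p).

Definition dE_dnu {R : realType} {n : nat} (E : 'rV[R]_n * 'cV[R]_n -> R)
    (p : 'rV[R]_n * 'cV[R]_n) : 'rV[R]_n :=
  vector_of (fun lambda => 'D_(0, lambda) E p).

Definition action {R : realType} {n : nat} (E : 'rV[R]_n * 'cV[R]_n -> R)
    (a b : R) (gamma : R -> 'rV[R]_n * 'cV[R]_n) : R :=
  \int[lebesgue_measure]_(t in `[a, b]) E (gamma t).

Definition reduced_variation {R : realType} {n : nat} {G : lieGroup R n}
    (c : chart G 'rV[R]_n) (gamma zeta : R -> 'rV[R]_n * 'cV[R]_n) (t : R) :
    'rV[R]_n * 'cV[R]_n :=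
  derive1 zeta t + semidirect_bracket c (gamma t) (zeta t).

(* [Gamma (e, t)] is a deformation of [gamma] whose variation
   d/de|_(e = 0) [Gamma (e, t)] is the reduced variation given by [zeta]. *)
Definition reduced_deformation {R : realType} {n : nat} {G : lieGroup R n}
    (c : chart G 'rV[R]_n) (a b : R) (gamma zeta : R -> 'rV[R]_n * 'cV[R]_n)
    (Gamma : R * R -> 'rV[R]_n * 'cV[R]_n) : Prop :=
  [/\ exists2 d : R, 0 < d & smooth_on (`]- d, d[ `*` `[a, b]) Gamma,
      forall t, t \in `[a, b] -> Gamma (0, t) = gamma t
    & forall t, t \in `[a, b] ->
        derive1 (fun e => Gamma (e, t)) 0 = reduced_variation c gamma zeta t].

Definition reduced_extremal {R : realType} {n : nat} {G : lieGroup R n}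
    (c : chart G 'rV[R]_n) (E : 'rV[R]_n * 'cV[R]_n -> R) (a b : R)
    (gamma : R -> 'rV[R]_n * 'cV[R]_n) : Prop :=
  forall (zeta : R -> 'rV[R]_n * 'cV[R]_n)
         (Gamma : R * R -> 'rV[R]_n * 'cV[R]_n),
    smooth_on `[a, b] zeta -> zeta a = 0 -> zeta b = 0 ->
    reduced_deformation c a b gamma zeta Gamma ->
    is_derive (0 : R) 1 (fun e => action E a b (fun t => Gamma (e, t))) 0.

(* Main.v *)
(* Let p = dE/dxi and q = dE/dnu along (xi, nu), and put
     r1 = p' - ad*_xi p + ad*_q nu,   r2 = q' + [xi, q].
   For the reduced variation given by (eta, lambda) the integrand of the first
   variation is d/dt (<p, eta> + <lambda, q>) - <r1, eta> - <lambda, r2>, by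
   antisymmetry of the bracket, so the first variation is minus the integral of
   <r1, eta> + <lambda, r2>. It vanishes if r1 = r2 = 0. Conversely, no bump
   function is needed: r1 and r2 are smooth, so
   (eta, lambda) = (t - a)(b - t) (r1^T, r2^T) is admissible, realised by the
   deformation (xi, nu) + e * variation, and makes the integrand positive
   wherever (r1, r2) is nonzero inside the interval. *)
Require Import Defs.
From HB Require Import structures.
From mathcomp Require Import all_boot all_order all_algebra.
From mathcomp Require Import all_classical all_reals all_analysis.
From mathcomp Require Import ring.
Import Order.TTheory GRing.Theory Num.Theory.
Import numFieldNormedType.Exports.
Local Open Scope classical_set_scope.
Local Open Scope ring_scope.
Set Implicit Arguments.
Unset Strict Implicit.
Unset Printing Implicit Defensive.

(** * Closure properties of C^k maps *)

(** The first order expansion at [x] involves only values near [x], so the one of [f] serves for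
    [g]; uniqueness of the differential then gives ['d g x = 'd f x]. *)
Lemma near_eq_differentiable (R : realType) (U V : normedModType R)
    (f g : U -> V) (x : U) :
  (\near x, f x = g x) -> differentiable f x -> differentiable g x.
Proof.
move=> fg df; have [dfc dfE] := (diff_locallyP x f).1 df.
suff gE : g \o shift x = cst (g x) + 'd f x +o_ 0 id.
  apply/diff_locallyP.
  have dgE : 'd g x = 'd f x :> (U -> V) by exact: diff_unique.
  by rewrite dgE.
apply/eqaddoP => e e0.
have /eqaddoP/(_ e e0) := dfE; apply: filter_app.
have : \forall h \near (0 : U), f (h + x) = g (h + x).
  by move: fg; rewrite (near_shift 0 x); apply: filterS => h; rewrite /= subr0.
apply: filter_app; near=> h => fgh.
by rewrite /= !fctE /= -fgh (nbhs_singleton fg).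
Unshelve. all: by end_near. Qed.

Lemma near_open (R : realType) (U : normedModType R) (O P : set U) (x : U) :
  open O -> O x -> O `<=` P -> \near x, P x.
Proof. by move=> oO Ox OP; apply: filterS OP _; exact: open_nbhs_nbhs. Qed.

Lemma Ck_on_sub (R : realType) (U V : normedModType R) k (O P : set U)
    (f : U -> V) : O `<=` P -> Ck_on k P f -> Ck_on k O f.
Proof.
elim: k f => [|k IH] f OP /=; first by move=> cf x /OP; exact: cf.
by move=> [df Df]; split=> [x /OP|v]; [exact: df|exact: IH].
Qed.

(** As [O] is open, agreement on [O] is agreement near each of its points; hence the directional
    derivatives agree on [O] too and the induction goes on. *)
Lemma Ck_on_ext (R : realType) (U V : normedModType R) k (O : set U)
    (f g : U -> V) : open O -> (forall x, O x -> f x = g x) ->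
  Ck_on k O f -> Ck_on k O g.
Proof.
move=> oO; elim: k f g => [|k IH] f g fg /=.
  move=> cf x Ox; have nfg : \near x, f x = g x by exact: near_open Ox _.
  rewrite /prop_for /continuous_at -(fg _ Ox).
  by apply: cvg_trans (cf _ Ox); exact: near_eq_cvg.
move=> [df Df]; split=> [x Ox|v].
  by apply: near_eq_differentiable (df _ Ox); exact: near_open Ox _.
by apply: IH (Df v) => x Ox; apply: near_eq_derive; exact: near_open Ox _.
Qed.

Lemma Ck_onW (R : realType) (U V : normedModType R) k (O : set U)
    (f : U -> V) : Ck_on k.+1 O f -> Ck_on k O f.
Proof.
elim: k f => [|k IH] f [df Df]; last by split=> // v; exact: IH.
by move=> x Ox; apply: differentiable_continuous; exact: df.
Qed.

Lemma Ck_on_cst (R : realType) (U V : normedModType R) k (O : set U) (a : V) :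
  Ck_on k O (fun _ : U => a).
Proof.
elim: k a => [|k IH] a; first by move=> x _; exact: cvg_cst.
split=> [x _|v]; first exact: differentiable_cst.
rewrite (_ : 'D_v _ = fun=> 0)//; apply/funext => x; exact: derive_cst.
Qed.

Lemma Ck_on_id (R : realType) (U : normedModType R) k (O : set U) :
  Ck_on k O (fun x : U => x).
Proof.
case: k => [|k]; first by move=> x _; exact: cvg_id.
split=> [x _|v]; first exact: ex_diff.
rewrite (_ : 'D_v _ = fun=> v); first exact: Ck_on_cst.
by apply/funext => x; exact: derive_id.
Qed.

Lemma Ck_onD (R : realType) (U V : normedModType R) k (O : set U)
    (f g : U -> V) : open O -> Ck_on k O f -> Ck_on k O g ->
  Ck_on k O (fun x => f x + g x).
Proof.
move=> oO; elim: k f g => [|k IH] f g.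
  by move=> cf cg x Ox; apply: cvgD; [exact: cf|exact: cg].
move=> [df Df] [dg Dg]; split=> [x Ox|v].
  by apply: differentiableD; [exact: df|exact: dg].
apply: Ck_on_ext (IH _ _ (Df v) (Dg v)) => // x Ox.
by rewrite -deriveD//; apply: diff_derivable; [exact: df|exact: dg].
Qed.

Lemma Ck_on_sum (R : realType) (U V : normedModType R) k (O : set U)
    (I : finType) (f : I -> U -> V) : open O ->
  (forall i, Ck_on k O (f i)) -> Ck_on k O (fun x => \sum_i f i x).
Proof.
move=> oO Cf; elim: (index_enum I) => [|i s IH].
  by apply: Ck_on_ext (@Ck_on_cst _ _ _ k O 0) => // x _; rewrite big_nil.
by apply: Ck_on_ext (Ck_onD oO (Cf i) IH) => // x _; rewrite big_cons.
Qed.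

Lemma Ck_onM (R : realType) (U : normedModType R) k (O : set U)
    (f g : U -> R) : open O -> Ck_on k O f -> Ck_on k O g ->
  Ck_on k O (fun x => f x * g x).
Proof.
move=> oO; elim: k f g => [|k IH] f g.
  by move=> cf cg x Ox; apply: cvgM; [exact: cf|exact: cg].
move=> Cf Cg; have [df Df] := Cf; have [dg Dg] := Cg.
split=> [x Ox|v].
  by apply: differentiableM; [exact: df|exact: dg].
(* Leibniz's rule contains [f] and [g] undifferentiated; these are taken one order lower. *)
have := Ck_onD oO (IH _ _ (Ck_onW Cf) (Dg v)) (IH _ _ (Ck_onW Cg) (Df v)).
apply: Ck_on_ext => // x Ox.
by rewrite deriveM//; apply: diff_derivable; [exact: df|exact: dg].
Qed.

(** Bundles a bare linear map, since the rules for differentials of linear maps are about bundled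
    ones. *)
Lemma linear_funP (R : realType) (V W : normedModType R) (L : V -> W) :
  linear L -> exists L' : {linear V -> W}, L' = L :> (V -> W).
Proof.
move=> linL; pose M := GRing.isLinear.Build _ _ _ _ _ linL.
by pose L' : {linear _ -> _} := HB.pack L M; exists L'.
Qed.

(** On [O], ['D_v (L \o f)] is [L \o 'D_v f], a composite of the same form, to which the induction
    applies. *)
Lemma Ck_on_linear_comp (R : realType) (U V W : normedModType R) k (O : set U)
    (L : V -> W) (f : U -> V) : linear L -> continuous L -> open O ->
  Ck_on k O f -> Ck_on k O (fun x => L (f x)).
Proof.
move=> /linear_funP[{}L <-] cL oO; elim: k f => [|k IH] f.
  by move=> cf x Ox; apply: continuous_comp; [exact: cf|exact: cL].
move=> [df Df]; have dL y := @linear_differentiable _ _ _ L y cL.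
split=> [x Ox|v].
  exact: (@differentiable_comp _ _ _ _ f L x (df _ Ox) (dL _)).
apply: Ck_on_ext (IH _ (Df v)) => // x Ox.
rewrite !deriveE; first by rewrite (diff_comp (df _ Ox) (dL _)) /= diff_lin.
- exact: (@differentiable_comp _ _ _ _ f L x (df _ Ox) (dL _)).
- exact: df.
Qed.

Lemma Ck_onN (R : realType) (U V : normedModType R) k (O : set U)
    (f : U -> V) : open O -> Ck_on k O f -> Ck_on k O (fun x => - f x).
Proof.
apply: (@Ck_on_linear_comp _ _ _ _ k O -%R f); last exact: opp_continuous.
by move=> a x y; rewrite opprD scalerN.
Qed.

(** Here ['D_v (f \o L)] is ['D_(L v) f \o L], again a composite with [L] on the right. *)
Lemma Ck_on_comp_linear (R : realType) (U V W : normedModType R) k (O : set V)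
    (L : U -> V) (f : V -> W) : linear L -> continuous L -> open O ->
  Ck_on k O f -> Ck_on k (L @^-1` O) (fun x => f (L x)).
Proof.
move=> /linear_funP[{}L <-] cL oO.
have oLO : open (L @^-1` O) by exact: open_comp.
elim: k f => [|k IH] f.
  by move=> cf x Ox; apply: continuous_comp; [exact: cL|exact: cf].
move=> [df Df]; have dL y := @linear_differentiable _ _ _ L y cL.
split=> [x Ox|v].
  exact: (@differentiable_comp _ _ _ _ L f x (dL _) (df _ Ox)).
apply: Ck_on_ext (IH _ (Df (L v))) => // x Ox.
rewrite !deriveE; first by rewrite (diff_comp (dL _) (df _ Ox)) /= diff_lin.
- exact: (@differentiable_comp _ _ _ _ L f x (dL _) (df _ Ox)).
- exact: df.
Qed.

Lemma Ck_on_pair (R : realType) (U V W : normedModType R) k (O : set U)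
    (f : U -> V) (g : U -> W) : open O -> Ck_on k O f -> Ck_on k O g ->
  Ck_on k O (fun x => (f x, g x)).
Proof.
move=> oO; elim: k f g => [|k IH] f g.
  by move=> cf cg x Ox; apply: cvg_pair; [exact: cf|exact: cg].
move=> [df Df] [dg Dg]; split=> [x Ox|v].
  by apply: differentiable_pair; [exact: df|exact: dg].
apply: Ck_on_ext (IH _ _ (Df v) (Dg v)) => // x Ox.
have ? := df _ Ox; have ? := dg _ Ox.
rewrite !deriveE//; first by rewrite diff_pair.
exact: differentiable_pair.
Qed.

Lemma Ck_on_coord (R : realType) (U : normedModType R) m n k (O : set U)
    (f : U -> 'M[R]_(m, n)) i j : open O -> Ck_on k O f ->
  Ck_on k O (fun x => f x i j : R).
Proof.
move=> oO Cf; apply: (@Ck_on_linear_comp _ _ _ _ k O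
  (fun M : 'M[R]_(m, n) => M i j) f) => //.
  by move=> a M N; rewrite !mxE.
exact: coord_continuous.
Qed.

(** A matrix is the finite sum of its entries times constant matrices, which reduces the claim to
    scalar functions. *)
Lemma Ck_on_mx (R : realType) (U : normedModType R) m n k (O : set U)
    (f : U -> 'M[R]_(m, n)) : open O ->
  (forall i j, Ck_on k O (fun x => f x i j : R)) -> Ck_on k O f.
Proof.
move=> oO Cf.
apply: (@Ck_on_ext _ _ _ k O
    (fun x => \sum_i \sum_j f x i j *: delta_mx i j)) => // [x _|].
  exact/esym/matrix_sum_delta.
apply: Ck_on_sum => // i; apply: Ck_on_sum => // j.
apply: (@Ck_on_linear_comp _ _ _ _ k O (fun a : R => a *: delta_mx i j)
  (fun x => f x i j)) => //.
  by move=> a u v; rewrite scalerDl scalerA.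
exact: scalel_continuous.
Qed.

Lemma Ck_on_scale (R : realType) (U : normedModType R) m n k (O : set U)
    (f : U -> R) (g : U -> 'M[R]_(m, n)) : open O ->
  Ck_on k O f -> Ck_on k O g -> Ck_on k O (fun x => f x *: g x).
Proof.
move=> oO Cf Cg; apply: Ck_on_mx => // i j.
apply: (@Ck_on_ext _ _ _ k O (fun x => f x * g x i j)) => // [x _|].
  by rewrite mxE.
by apply: Ck_onM => //; exact: Ck_on_coord.
Qed.

Lemma Ck_on_trmx (R : realType) (U : normedModType R) m n k (O : set U)
    (g : U -> 'M[R]_(m, n)) : open O ->
  Ck_on k O g -> Ck_on k O (fun x => (g x)^T).
Proof.
move=> oO Cg; apply: Ck_on_mx => // i j.
apply: (@Ck_on_ext _ _ _ k O (fun x => g x j i)) => // [x _|].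
  by rewrite mxE.
exact: Ck_on_coord.
Qed.

(** With coordinates [l i] along vectors [b i], the chain rule writes ['D_v (F \o g)] as the sum of
    the products of [l i ('D_v g)] and ['D_(b i) F \o g]. Each second factor is a composite with the
    same [g], so the induction varies [F] alone; assuming all orders at once avoids counting
    them. *)
Lemma Ck_on_comp (R : realType) (U V : normedModType R) (I : finType)
    (b : I -> V) (l : I -> V -> R) (O : set U) (P : set V) (g : U -> V)
    (F : V -> R) :
  (forall i, linear (l i)) -> (forall i, continuous (l i)) ->
  (forall v, v = \sum_i l i v *: b i) -> open O -> (forall x, O x -> P (g x)) ->
  (forall k, Ck_on k O g) -> (forall k, Ck_on k P F) ->
  forall k, Ck_on k O (fun x => F (g x)).
Proof.
move=> linl cl bl oO OP Cg CF k; elim: k F CF => [|k IH] F CF.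
  move=> x Ox; apply: continuous_comp; first exact: (Cg 0%N).
  exact/(CF 0%N)/OP.
have dg x : O x -> differentiable g x by exact: (Cg 1%N).1.
have dF x : O x -> differentiable F (g x) by move=> /OP; exact: (CF 1%N).1.
split=> [x Ox|v].
  exact: (@differentiable_comp _ _ _ _ g F x (dg _ Ox) (dF _ Ox)).
apply: (@Ck_on_ext _ _ _ k O
    (fun x => \sum_i l i ('D_v g x) * 'D_(b i) F (g x))) => // [x Ox|].
  rewrite [RHS]deriveE; last first.
    exact: (@differentiable_comp _ _ _ _ g F x (dg _ Ox) (dF _ Ox)).
  rewrite (diff_comp (dg _ Ox) (dF _ Ox)) /= -(deriveE _ (dg _ Ox)).
  rewrite [in RHS](bl ('D_v g x)) linear_sum; apply: eq_bigr => i _.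
  by rewrite linearZ /= (deriveE _ (dF _ Ox)).
apply: Ck_on_sum => // i; apply: Ck_onM => //.
  apply: (@Ck_on_linear_comp _ _ _ _ k O (l i) ('D_v g)) => //.
  exact: (Cg k.+1).2.
by apply: (IH ('D_(b i) F)) => j; exact: (CF j.+1).2.
Qed.

Lemma Ck_on_comp_prod_mx (R : realType) (U : normedModType R) m n p q
    (O : set U) (P : set ('M[R]_(m, n) * 'M[R]_(p, q)))
    (g : U -> 'M[R]_(m, n) * 'M[R]_(p, q)) (F : _ -> R) :
  open O -> (forall x, O x -> P (g x)) ->
  (forall k, Ck_on k O g) -> (forall k, Ck_on k P F) ->
  forall k, Ck_on k O (fun x => F (g x)).
Proof.
(* Coordinates on the product: the elementary matrices of either factor, with the matching
   entries. *)
pose b (i : ('I_m * 'I_n) + ('I_p * 'I_q)) :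
    'M[R]_(m, n) * 'M[R]_(p, q) :=
  match i with
  | inl i => (delta_mx i.1 i.2, 0)
  | inr i => (0, delta_mx i.1 i.2)
  end.
pose l (i : ('I_m * 'I_n) + ('I_p * 'I_q))
    (v : 'M[R]_(m, n) * 'M[R]_(p, q)) : R :=
  match i with inl i => v.1 i.1 i.2 | inr i => v.2 i.1 i.2 end.
apply: (@Ck_on_comp _ _ _ _ b l).
- by move=> [i|i] a u v; rewrite /l/= !mxE.
- move=> [i|i] v.
  + apply: (@continuous_comp _ _ _ fst (fun M : 'M[R]_(m, n) => M i.1 i.2)).
      exact: cvg_fst.
    exact: coord_continuous.
  + apply: (@continuous_comp _ _ _ snd (fun M : 'M[R]_(p, q) => M i.1 i.2)).
      exact: cvg_snd.
    exact: coord_continuous.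
- move=> [v w]; rewrite big_sumType/= [v in LHS]matrix_sum_delta.
  rewrite [w in LHS]matrix_sum_delta !pair_bigA/=.
  apply: injective_projections; rewrite /= !raddf_sum /=.
    by rewrite [X in _ + X]big1 ?addr0// => i _; rewrite scaler0.
  by rewrite [X in X + _]big1 ?add0r// => i _; rewrite scaler0.
Qed.

(** * The Lie bracket *)

(** Both sides are the limit of one and the same difference quotient. *)
Lemma derive_pairl (R : realType) (U V W : normedModType R) (f : U * V -> W)
    (x u : U) (y : V) : 'D_u (fun z => f (z, y)) x = 'D_(u, 0) f (x, y).
Proof.
rewrite /derive; apply: (congr1 (fun g : R -> W => lim (g @ 0^'))).
apply/funext => h /=.
by rewrite -[h *: (u, 0) + (x, y)]/(h *: u + x, h *: 0 + y) scaler0 add0r.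
Qed.

Lemma derive_pairr (R : realType) (U V W : normedModType R) (f : U * V -> W)
    (x : U) (y v : V) : 'D_v (fun z => f (x, z)) y = 'D_(0, v) f (x, y).
Proof.
rewrite /derive; apply: (congr1 (fun g : R -> W => lim (g @ 0^'))).
apply/funext => h /=.
by rewrite -[h *: (0, v) + (x, y)]/(h *: 0 + x, h *: v + y) scaler0 add0r.
Qed.

Definition chart_mul {R : realType} {n : nat} {G : lieGroup R n}
    (c : chart G 'rV[R]_n) (p : 'rV[R]_n * 'rV[R]_n) : 'rV[R]_n :=
  c (chart_inv c p.1 * chart_inv c p.2)%g.

Section lie_bracket.
Context {R : realType} {n : nat} {G : lieGroup R n} (c : chart G 'rV[R]_n).
Hypotheses (hc : lie_atlas c) (hc1 : chart_dom c 1%g).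
Local Notation e := (c 1%g).
Local Notation m := (chart_mul c).

Lemma right_invariant_fieldE xi y :
  right_invariant_field c xi y = 'D_(xi, 0) m (e, y).
Proof. by rewrite /right_invariant_field -derive_pairl. Qed.

(** Right translation by the unit, read in the chart, is the identity near [e]. *)
Lemma right_invariant_field1 xi : right_invariant_field c xi e = xi.
Proof.
rewrite -[RHS](derive_id e xi); apply: near_eq_derive.
apply: (near_open (chart_img_open c)); first exact: chart_map_img.
by move=> x cx /=; rewrite chart_mapK// mulg1 chart_invK.
Qed.

(** Since X_xi(e) = xi, the Jacobi-Lie bracket at the unit is a difference of mixed second
    derivatives of the multiplication; antisymmetry and bilinearity are read off from this form. *)
Lemma lie_bracketE xi eta : lie_bracket c xi eta =
  'D_(0, xi) ('D_(eta, 0) m) (e, e) - 'D_(0, eta) ('D_(xi, 0) m) (e, e).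
Proof.
have XE zeta : right_invariant_field c zeta = fun y => 'D_(zeta, 0) m (e, y).
  by apply/funext => y; exact: right_invariant_fieldE.
rewrite /lie_bracket /jacobi_lie !right_invariant_field1 !XE.
exact: (congr2 (fun x y => x - y) (derive_pairr ('D_(eta, 0) m) e e xi)
  (derive_pairr ('D_(xi, 0) m) e e eta)).
Qed.

Lemma lie_bracketC xi eta : lie_bracket c xi eta = - lie_bracket c eta xi.
Proof. by rewrite !lie_bracketE opprB. Qed.

Lemma chart_mul_smooth :
  exists2 O, open O & O (e, e) /\ forall k, Ck_on k O m.
Proof.
have [P [openP OP CO]] := lie_mul_smooth hc hc hc; exists P => //; split=> //.
apply: OP => /=; split; [exact: chart_map_img..|].
by rewrite chart_mapK// mulg1.
Qed.

Lemma lie_bracket_linear xi : linear (lie_bracket c xi).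
Proof.
move=> a eta eta'; have [P openP [Pe CO]] := chart_mul_smooth.
have dm p : P p -> differentiable m p by exact: (CO 1%N).1.
have dDm u p : P p -> differentiable ('D_u m) p by exact: ((CO 2%N).2 u).1.
rewrite !lie_bracketE scalerBr addrACA -opprD; congr (_ - _).
  rewrite -deriveZ; last exact/diff_derivable/dDm.
  rewrite -deriveD; last 2 first.
  - by apply/diff_derivable/differentiableZ/dDm.
  - exact/diff_derivable/dDm.
  (* In the first term [eta] is the inner direction: linearity is needed at all points near (e, e),
     because the outer derivative acts on the resulting function. *)
  apply: near_eq_derive; apply: (near_open openP Pe) => p Op.
  rewrite !fctE !(deriveE _ (dm _ Op)).
  have -> : (a *: eta + eta', 0) =
      a *: (eta, 0) + (eta', 0) :> 'rV[R]_n * 'rV[R]_n.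
    by apply: injective_projections; rewrite /= ?scaler0 ?addr0.
  by rewrite linearP -(deriveE (eta, 0) (dm _ Op)).
(* In the second term [eta] is the outer direction, so linearity of the differential at (e, e) is
   enough. *)
rewrite !(deriveE _ (dDm _ _ Pe)).
have -> : (0, a *: eta + eta') =
    a *: (0, eta) + (0, eta') :> 'rV[R]_n * 'rV[R]_n.
  by apply: injective_projections; rewrite /= ?scaler0 ?addr0.
by rewrite linearP.
Qed.

Lemma lie_bracket_linearl eta : linear (lie_bracket c ^~ eta).
Proof.
by move=> a u v; rewrite /= ![lie_bracket c _ eta]lie_bracketC
  lie_bracket_linear opprD scalerN.
Qed.

(** Expansion in structure constants; it reduces the smoothness of a bracket of maps to products of
    coordinates. *)
Lemma lie_bracket_coord xi eta : lie_bracket c xi eta =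
  \sum_i \sum_j (xi 0 i * eta 0 j) *:
    lie_bracket c (delta_mx 0 i) (delta_mx 0 j).
Proof.
have [L LE] := linear_funP (lie_bracket_linearl eta).
rewrite -[LHS]/((lie_bracket c ^~ eta) xi) -LE {1}(row_sum_delta xi) linear_sum.
apply: eq_bigr => i _; rewrite linearZ LE/=.
have [L' L'E] := linear_funP (lie_bracket_linear (delta_mx 0 i)).
rewrite -L'E {1}(row_sum_delta eta) linear_sum scaler_sumr.
by apply: eq_bigr => j _; rewrite linearZ scalerA.
Qed.

End lie_bracket.

(** * Integrals over a segment *)

Section integrals.
Context {R : realType}.
Implicit Types (a b : R) (O : set R).
Local Notation mu := (@lebesgue_measure R).

Lemma Ck_on0_within (U V : normedModType R) (O A : set U) (f : U -> V) :
  A `<=` O -> Ck_on 0 O f -> {within A, continuous f}.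
Proof.
by move=> AO cf; apply: continuous_in_subspaceT => x /set_mem/AO; exact: cf.
Qed.

Lemma Ck_on0_integrable a b O (f : R -> R) : `[a, b] `<=` O -> Ck_on 0 O f ->
  mu.-integrable `[a, b] (EFin \o f).
Proof.
move=> abO cf; apply: continuous_compact_integrable.
  exact: segment_compact.
exact: Ck_on0_within cf.
Qed.

Lemma Rintegral_derive a b O (W : R -> R) : a < b -> open O -> `[a, b] `<=` O ->
  Ck_on 1 O W -> \int[mu]_(t in `[a, b]) 'D_1 W t = W b - W a.
Proof.
move=> ab oO abO CW; have cDW : Ck_on 0 O ('D_1 W) by exact: CW.2.
rewrite /Rintegral (@continuous_FTC2 _ _ W)//.
- exact: Ck_on0_within cDW.
- have cW x : x \in `[a, b] -> {for x, continuous W}.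
    by move=> /abO; exact: (Ck_onW CW).
  split.
  + move=> x /subset_itv_oo_cc/abO Ox.
    by apply: diff_derivable; exact: CW.1.
  + by apply: cvg_at_right_filter; apply: cW; rewrite bound_itvE ltW.
  + by apply: cvg_at_left_filter; apply: cW; rewrite bound_itvE ltW.
- by move=> x _; rewrite derive1E.
Qed.

(** If [w t] were positive, continuity would give [w t / 2 <= w] on some [t - d, t + d] inside the
    segment, and the integral would be at least [w t * d]. *)
Lemma Rintegral_ge0_eq0 a b O (w : R -> R) : open O -> `[a, b] `<=` O ->
  Ck_on 0 O w -> (forall t, `[a, b]%classic t -> 0 <= w t) ->
  \int[mu]_(t in `[a, b]) w t = 0 -> forall t, `]a, b[%classic t -> w t = 0.
Proof.
move=> oO abO cw w0 Iw t tab; apply/eqP/negPn/negP => wt.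
have tab' := subset_itv_oo_cc tab.
have {}wt : 0 < w t by rewrite lt_def wt w0.
have [d /= d0 dw] : exists2 d : R, 0 < d &
    forall s, `[t - d, t + d]%classic s -> `[a, b]%classic s /\ w t / 2 <= w s.
  have : \forall s \near t, `[a, b]%classic s /\ w t / 2 <= w s.
    have n1 : \forall s \near t, `[a, b]%classic s.
      have /near_in_itvoo : t \in `]a, b[ by [].
      by apply: filterS => s; exact: subset_itv_oo_cc.
    have n2 : \forall s \near t, w t / 2 <= w s.
      apply: (cvgr_ge (w t) (cw _ (abO _ tab'))).
      by rewrite ltr_pdivrMr// mulr_natr mulr2n ltrDl.
    by apply: filterS2 n1 n2 => s.
  move=> /nbhs_ballP[e /= e0 et]; exists (e / 2); first exact: divr_gt0.
  move=> s /=; rewrite in_itv /= -ler_distlC => st.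
  apply: et; rewrite /ball /=; apply: le_lt_trans st _.
  by rewrite ltr_pdivrMr// mulr_natr mulr2n ltrDl.
have intw := Ck_on0_integrable abO cw.
have mw := measurable_int _ intw.
have td : t - d < t + d by rewrite ltrD2l gtrN.
have : ((w t / 2 * (t + d - (t - d)))%:E <= \int[mu]_(s in `[a, b]) (w s)%:E)%E.
  apply: (@le_trans _ _ (\int[mu]_(s in `[(t - d)%R, (t + d)%R]) (w s)%:E)%E).
    rewrite (_ : _%:E = \int[mu]_(s in `[(t - d)%R, (t + d)%R]) (w t / 2)%:E)%E.
      apply: ge0_le_integral => //.
      - by move=> s _; rewrite lee_fin divr_ge0// ltW.
      - by apply: measurable_funS mw; [exact: measurable_itv|move=> s /dw[]].
      - by move=> s /dw[_ ws]; rewrite lee_fin.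
    by rewrite integral_cst//= lebesgue_measure_itv/= lte_fin td EFinM EFinB.
  by apply: ge0_subset_integral => // s /dw[].
rewrite -(fineK (integrable_fin_num _ intw)); last exact: measurable_itv.
rewrite -[fine _]/(\int[mu]_(s in `[a, b]) w s) Iw lee_fin leNgt mulr_gt0//.
  by rewrite divr_gt0.
by rewrite subr_gt0.
Qed.

(** Differentiation under the integral sign, dominated by a constant: the partial derivative is
    continuous, hence bounded on a compact rectangle. *)
Lemma is_derive_Rintegral a b (d : R) (O : set (R * R)) (h : R * R -> R) :
  0 < d -> open O -> `]- d, d[ `*` `[a, b] `<=` O -> Ck_on 1 O h ->
  is_derive (0 : R) 1 (fun e => \int[mu]_(t in `[a, b]) h (e, t))
    (\int[mu]_(t in `[a, b]) 'D_(1, 0) h (0, t)).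
Proof.
move=> d0 oO dO Ch; have d2 : 0 < d / 2 by exact: divr_gt0.
have d2d : d / 2 < d by rewrite ltr_pdivrMr// mulr_natr mulr2n ltrDl.
(* Halving [d] gives a closed rectangle still inside [O]; its compactness provides the bound [M]. *)
have d2O : `[- (d / 2), d / 2] `*` `[a, b] `<=` O.
  move=> [e t] [/= ed tab]; apply: dO; split=> //=.
  move: ed; rewrite !in_itv/= => /andP[ed1 ed2].
  by rewrite (lt_le_trans _ ed1) ?ltrN2// (le_lt_trans ed2).
have I0 : `]- (d / 2), d / 2[%classic (0 : R).
  by rewrite /= in_itv/= oppr_lt0 d2.
have dOI e t : `]- (d / 2), d / 2[%classic e -> `[a, b]%classic t -> O (e, t).
  by move=> eI tab; apply: d2O; split=> //=; exact: subset_itv_oo_cc.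
have cDh : Ck_on 0 O ('D_(1, 0) h) by exact: Ch.2.
have ch : Ck_on 0 O h by exact: Ck_onW.
pose f (e t : R) := h (e, t).
have d1f e t : partial1of2 f e t = 'D_(1, 0) h (e, t).
  by rewrite partial1of2E derive_pairl.
have [M M0 hM] : exists2 M : R, 0 < M &
    forall e t, `]- (d / 2), d / 2[%classic e -> `[a, b]%classic t ->
    `|partial1of2 f e t| <= M.
  have : bounded_set ('D_(1, 0) h @` (`[- (d / 2), d / 2] `*` `[a, b])).
    apply: compact_bounded; apply: continuous_compact.
      exact: Ck_on0_within cDh.
    by apply: compact_setX; exact: segment_compact.
  move=> /ex_strict_bound_gt0[M M0 hM]; exists M => // e t eI tab.
  rewrite d1f; apply/ltW/hM; exists (e, t) => //; split=> //=.
  exact: subset_itv_oo_cc.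
have intf e : `]- (d / 2), d / 2[%classic e ->
    mu.-integrable `[a, b] (EFin \o f e).
  move=> eI; apply: continuous_compact_integrable; first exact: segment_compact.
  apply: continuous_in_subspaceT => t /set_mem tab.
  have dt : differentiable (fun t : R => (e, t)) t.
    by apply: differentiable_pair; [exact: differentiable_cst|exact: ex_diff].
  apply: (@continuous_comp _ _ _ (fun t : R => (e, t)) h).
    exact: differentiable_continuous.
  by apply: ch; exact: dOI.
have derf e t : `]- (d / 2), d / 2[%classic e -> `[a, b]%classic t ->
    derivable (f ^~ t) e 1.
  move=> eI tab; apply/derivable1_diffP.
  apply: (@differentiable_comp _ _ _ _ (fun e : R => (e, t)) h).
    by apply: differentiable_pair; [exact: ex_diff|exact: differentiable_cst].
  by apply: Ch.1; exact: dOI.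
have intM : mu.-integrable `[a, b] (EFin \o (fun _ : R => M)).
  apply: continuous_compact_integrable; first exact: segment_compact.
  by apply: continuous_in_subspaceT => t _; exact: cvg_cst.
have mI : measurable (`[a, b] : set (measurableTypeR R)).
  exact: measurable_itv.
have M0' : forall t : R, 0 <= M by move=> _; exact: ltW.
apply: DeriveDef.
  exact: (@derivable_under_integral _ _ _ mu f _ mI _ _ _ I0 intf derf _ M0'
    intM hM).
rewrite -derive1E (@differentiation_under_integral _ _ _ mu f _ mI _ _ _ I0
  intf derf _ M0' intM hM).
by apply: eq_Rintegral => t _; exact: d1f.
Qed.

End integrals.

(** * The pairing and the gradient of the Lagrangian *)

Lemma pairingE (R : realType) n (mu : 'cV[R]_n) (eta : 'rV[R]_n) :
  pairing mu eta = \sum_i eta 0 i * mu i 0.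
Proof. by rewrite /pairing mxE. Qed.

Lemma pairingDl (R : realType) n (mu nu : 'cV[R]_n) (eta : 'rV[R]_n) :
  pairing (mu + nu) eta = pairing mu eta + pairing nu eta.
Proof. by rewrite /pairing mulmxDr mxE. Qed.

Lemma pairingNl (R : realType) n (mu : 'cV[R]_n) (eta : 'rV[R]_n) :
  pairing (- mu) eta = - pairing mu eta.
Proof. by rewrite /pairing mulmxN mxE. Qed.

Lemma pairingZl (R : realType) n a (mu : 'cV[R]_n) (eta : 'rV[R]_n) :
  pairing (a *: mu) eta = a * pairing mu eta.
Proof. by rewrite /pairing -scalemxAr mxE. Qed.

Lemma pairingDr (R : realType) n (mu : 'cV[R]_n) (eta zeta : 'rV[R]_n) :
  pairing mu (eta + zeta) = pairing mu eta + pairing mu zeta.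
Proof. by rewrite /pairing mulmxDl mxE. Qed.

Lemma pairingNr (R : realType) n (mu : 'cV[R]_n) (eta : 'rV[R]_n) :
  pairing mu (- eta) = - pairing mu eta.
Proof. by rewrite /pairing mulNmx mxE. Qed.

Lemma pairingZr (R : realType) n (mu : 'cV[R]_n) a (eta : 'rV[R]_n) :
  pairing mu (a *: eta) = a * pairing mu eta.
Proof. by rewrite /pairing -scalemxAl mxE. Qed.

Lemma pairing_tr_ge0 (R : realType) n (mu : 'cV[R]_n) : 0 <= pairing mu mu^T.
Proof.
by rewrite pairingE sumr_ge0// => i _; rewrite mxE -expr2 sqr_ge0.
Qed.

Lemma pairing_tr_eq0 (R : realType) n (mu : 'cV[R]_n) :
  pairing mu mu^T = 0 -> mu = 0.
Proof.
rewrite pairingE => mu0; apply/matrixP => i j; rewrite ord1 mxE.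
have sq k : true -> 0 <= mu^T 0 k * mu k 0 by rewrite mxE -expr2 sqr_ge0.
have /eqP := psumr_eq0P sq mu0 (i := i) isT.
by rewrite mxE mulf_eq0 orbb => /eqP.
Qed.

Lemma pairing_trl_ge0 (R : realType) n (eta : 'rV[R]_n) :
  0 <= pairing eta^T eta.
Proof. by have := pairing_tr_ge0 eta^T; rewrite trmxK. Qed.

Lemma pairing_trl_eq0 (R : realType) n (eta : 'rV[R]_n) :
  pairing eta^T eta = 0 -> eta = 0.
Proof.
move=> eta0; have := @pairing_tr_eq0 _ _ eta^T; rewrite trmxK => /(_ eta0).
by move=> /(congr1 trmx); rewrite trmxK trmx0.
Qed.

(** Unbundled form, for functionals built from the bracket or from derivatives of [E], whose
    linearity is proved on the spot. *)
Lemma pairing_covector (R : realType) n (l : 'rV[R]_n -> R) eta :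
  linear l -> pairing (covector_of l) eta = l eta.
Proof.
move=> linl; pose M := GRing.isLinear.Build R _ _ *%R l linl.
by pose l' : {scalar 'rV[R]_n} := HB.pack l M; exact: (covector_ofE l').
Qed.

Lemma pairing_vector (R : realType) n (l : 'cV[R]_n -> R) mu :
  linear l -> pairing mu (vector_of l) = l mu.
Proof.
move=> linl; pose M := GRing.isLinear.Build R _ _ *%R l linl.
by pose l' : {scalar 'cV[R]_n} := HB.pack l M; exact: (vector_ofE l').
Qed.

Lemma Ck_on_pairing (R : realType) (U : normedModType R) n k (O : set U)
    (f : U -> 'cV[R]_n) (g : U -> 'rV[R]_n) : open O ->
  Ck_on k O f -> Ck_on k O g -> Ck_on k O (fun x => pairing (f x) (g x)).
Proof.
move=> oO Cf Cg.
apply: (@Ck_on_ext _ _ _ k O (fun x => \sum_i g x 0 i * f x i 0)) => // [x _|].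
  by rewrite pairingE.
by apply: Ck_on_sum => // i; apply: Ck_onM => //; exact: Ck_on_coord.
Qed.

(** The pairing is a finite sum of products of coordinates, so Leibniz's rule applies term by
    term. *)
Lemma derive_pairing (R : realType) (U : normedModType R) n
    (f : U -> 'cV[R]_n) (g : U -> 'rV[R]_n) x v :
  differentiable f x -> differentiable g x ->
  'D_v (fun x => pairing (f x) (g x)) x =
  pairing ('D_v f x) (g x) + pairing (f x) ('D_v g x).
Proof.
move=> df dg.
have fd i : derivable (fun x => f x i 0 : R) x v.
  by apply: (derivable_mxP _ _ _).1; exact: diff_derivable.
have gd i : derivable (fun x => g x 0 i : R) x v.
  by apply: (derivable_mxP _ _ _).1; exact: diff_derivable.
have -> : (fun x => pairing (f x) (g x)) =
    \sum_i ((fun x => g x 0 i : R) * (fun x => f x i 0 : R)).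
  by apply/funext => y; rewrite pairingE fct_sumE.
rewrite derive_sum; last by move=> i; exact: derivableM.
rewrite !pairingE -big_split; apply: eq_bigr => i _ /=.
rewrite deriveM// (derive_mx (@diff_derivable _ _ _ f x v df))
  (derive_mx (@diff_derivable _ _ _ g x v dg)).
by rewrite !mxE; congr (_ + _); exact: mulrC.
Qed.

(** * The coadjoint action, and smoothness of brackets of smooth maps *)

Section coad.
Context {R : realType} {n : nat} {G : lieGroup R n} (c : chart G 'rV[R]_n).
Hypotheses (hc : lie_atlas c) (hc1 : chart_dom c 1%g).

(** [coad] records values on basis vectors only; linearity of the bracket in its second argument
    makes it dual to the bracket on every [eta]. *)
Lemma pairing_coad xi mu eta :
  pairing (coad c xi mu) eta = pairing mu (lie_bracket c xi eta).
Proof.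
apply: pairing_covector => a u v.
by rewrite (lie_bracket_linear hc hc1) pairingDr pairingZr.
Qed.

Lemma Ck_on_lie_bracket (U : normedModType R) k (O : set U)
    (f g : U -> 'rV[R]_n) : open O -> Ck_on k O f -> Ck_on k O g ->
  Ck_on k O (fun x => lie_bracket c (f x) (g x)).
Proof.
move=> oO Cf Cg; apply: (@Ck_on_ext _ _ _ k O (fun x => \sum_i \sum_j
    (f x 0 i * g x 0 j) *: lie_bracket c (delta_mx 0 i) (delta_mx 0 j))) => //.
  by move=> x _; rewrite -lie_bracket_coord.
apply: Ck_on_sum => // i; apply: Ck_on_sum => // j.
apply: (@Ck_on_linear_comp _ _ _ _ k O
  (fun a : R => a *: lie_bracket c (delta_mx 0 i) (delta_mx 0 j))
  (fun x => f x 0 i * g x 0 j)) => //.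
- by move=> a u v; rewrite scalerDl scalerA.
- exact: scalel_continuous.
- by apply: Ck_onM => //; exact: Ck_on_coord.
Qed.

Lemma Ck_on_coad (U : normedModType R) k (O : set U)
    (f : U -> 'rV[R]_n) (g : U -> 'cV[R]_n) : open O ->
  Ck_on k O f -> Ck_on k O g -> Ck_on k O (fun x => coad c (f x) (g x)).
Proof.
move=> oO Cf Cg; apply: Ck_on_mx => // i j.
apply: (@Ck_on_ext _ _ _ k O
    (fun x => pairing (g x) (lie_bracket c (f x) (delta_mx 0 i)))) => //.
  by move=> x _; rewrite mxE.
apply: Ck_on_pairing => //; apply: Ck_on_lie_bracket => //; exact: Ck_on_cst.
Qed.

End coad.

(** The differential is linear and (u, w) = (u, 0) + (0, w). *)
Lemma derive_dE (R : realType) n (E : 'rV[R]_n * 'cV[R]_n -> R) p u w :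
  differentiable E p ->
  'D_(u, w) E p = pairing (dE_dxi E p) u + pairing w (dE_dnu E p).
Proof.
move=> dE; rewrite pairing_covector; last first.
  move=> a x y; rewrite !deriveE//.
  have -> : (a *: x + y, 0) = a *: (x, 0) + (y, 0) :> 'rV[R]_n * 'cV[R]_n.
    by apply: injective_projections; rewrite /= ?scaler0 ?addr0.
  by rewrite linearP.
rewrite pairing_vector; last first.
  move=> a x y; rewrite !deriveE//.
  have -> : (0, a *: x + y) = a *: (0, x) + (0, y) :> 'rV[R]_n * 'cV[R]_n.
    by apply: injective_projections; rewrite /= ?scaler0 ?addr0.
  by rewrite linearP.
rewrite !deriveE// -linearD; congr ('d E p _).
by apply: injective_projections; rewrite /= ?addr0 ?add0r.
Qed.

(** * Smoothness of the partial gradients along a smooth map *)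

Section smooth_gradient.
Context {R : realType} {n : nat} {U : normedModType R}.
Variables (E : 'rV[R]_n * 'cV[R]_n -> R) (O : set U)
  (gamma : U -> 'rV[R]_n * 'cV[R]_n).
Hypotheses (CE : forall k, Ck_on k setT E) (oO : open O)
  (Cg : forall k, Ck_on k O gamma).

Lemma Ck_on_dE v k : Ck_on k O (fun t => 'D_v E (gamma t)).
Proof.
apply: (@Ck_on_comp_prod_mx _ _ _ _ _ _ O setT gamma ('D_v E)) => // j.
exact: (CE j.+1).2.
Qed.

Lemma Ck_on_dE_dxi k : Ck_on k O (fun t => dE_dxi E (gamma t)).
Proof.
apply: Ck_on_mx => // i j.
by apply: Ck_on_ext (Ck_on_dE (delta_mx 0 i, 0) k) => // t _; rewrite mxE.
Qed.

Lemma Ck_on_dE_dnu k : Ck_on k O (fun t => dE_dnu E (gamma t)).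
Proof.
apply: Ck_on_mx => // i j.
by apply: Ck_on_ext (Ck_on_dE (0, delta_mx j 0) k) => // t _; rewrite mxE.
Qed.

End smooth_gradient.

(** * The first variation *)

(* For an abstract bracket, because unification unfolds [lie_bracket] down to
   limits. *)
Lemma reduced_variation_identity (R : realType) n
    (br : 'rV[R]_n -> 'rV[R]_n -> 'rV[R]_n)
    (cobr : 'rV[R]_n -> 'cV[R]_n -> 'cV[R]_n)
    (x v v' q q' : 'rV[R]_n) (y w w' p p' : 'cV[R]_n) :
  (forall x y, br x y = - br y x) ->
  (forall x mu y, pairing (cobr x mu) y = pairing mu (br x y)) ->
  pairing p (v' + br x v) + pairing (w' + (cobr v y - cobr x w)) q =
  pairing p' v + pairing p v' + (pairing w' q + pairing w q') -
  (pairing (p' - (cobr x p - cobr q y)) v + pairing w (q' + br x q)).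
Proof.
move=> brC cobrE.
rewrite !pairingDr !(pairingDl, pairingNl) !cobrE (brC q v) pairingNr.
ring.
Qed.

Section first_variation.
Context {R : realType} {n : nat} {G : lieGroup R n} (c : chart G 'rV[R]_n).
Variables (E : 'rV[R]_n * 'cV[R]_n -> R) (xi : R -> 'rV[R]_n)
  (nu : R -> 'cV[R]_n) (a b : R) (O : set R).
Hypotheses (hc : lie_atlas c) (hc1 : chart_dom c 1%g).
Hypotheses (CE : forall k, Ck_on k setT E) (ab : a < b) (oO : open O)
  (abO : `[a, b] `<=` O) (Cxi : forall k, Ck_on k O xi)
  (Cnu : forall k, Ck_on k O nu).

Let gamma t := (xi t, nu t).
Let p t := dE_dxi E (gamma t).
Let q t := dE_dnu E (gamma t).

(** This and [residual_nu] are the r1 and r2 of the outline: on [O] they vanish exactly where the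
    respective equation holds. *)
Definition residual_xi (t : R) : 'cV[R]_n :=
  'D_1 p t - (coad c (xi t) (p t) - coad c (q t) (nu t)).

Definition residual_nu (t : R) : 'rV[R]_n :=
  'D_1 q t + lie_bracket c (xi t) (q t).

Let Cgamma k : Ck_on k O gamma. Proof. exact: Ck_on_pair. Qed.

Let Cp k : Ck_on k O p. Proof. exact: Ck_on_dE_dxi. Qed.

Let Cq k : Ck_on k O q. Proof. exact: Ck_on_dE_dnu. Qed.

Lemma Ck_on_residual_xi k : Ck_on k O residual_xi.
Proof.
apply: Ck_onD => //; first exact: (Cp k.+1).2.
apply: Ck_onN => //; apply: Ck_onD => //; first exact: Ck_on_coad.
by apply: Ck_onN => //; exact: Ck_on_coad.
Qed.

Lemma Ck_on_residual_nu k : Ck_on k O residual_nu.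
Proof.
apply: Ck_onD => //; first exact: (Cq k.+1).2.
exact: Ck_on_lie_bracket.
Qed.

Section variation.
Variable zeta : R -> 'rV[R]_n * 'cV[R]_n.
Hypothesis Czeta : forall k, Ck_on k O zeta.

Let eta t := (zeta t).1.
Let lambda t := (zeta t).2.

Let Ceta k : Ck_on k O eta.
Proof.
apply: (@Ck_on_linear_comp _ _ _ _ k O fst zeta) => // x.
exact: cvg_fst.
Qed.

Let Clambda k : Ck_on k O lambda.
Proof.
apply: (@Ck_on_linear_comp _ _ _ _ k O snd zeta) => // x.
exact: cvg_snd.
Qed.

Lemma derive1_fst_snd t : O t -> derive1 zeta t = ('D_1 eta t, 'D_1 lambda t).
Proof.
move=> Ot; have zetaE : zeta = fun t => (eta t, lambda t).
  by apply/funext => s; rewrite /eta /lambda -surjective_pairing.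
have deta := (Ceta 1).1 _ Ot; have dlambda := (Clambda 1).1 _ Ot.
rewrite derive1E {1}zetaE deriveE; last exact: differentiable_pair.
by rewrite diff_pair// !deriveE.
Qed.

(** Lets the variation itself serve as the direction of a smooth deformation. *)
Lemma Ck_on_reduced_variation k : Ck_on k O (reduced_variation c gamma zeta).
Proof.
apply: (@Ck_on_ext _ _ _ k O (fun t =>
   ('D_1 eta t + lie_bracket c (xi t) (eta t),
    'D_1 lambda t + (coad c (eta t) (nu t) - coad c (xi t) (lambda t))))) => //.
  by move=> t Ot; rewrite /reduced_variation derive1_fst_snd.
apply: Ck_on_pair => //; apply: Ck_onD => //.
- exact: (Ceta k.+1).2.
- exact: Ck_on_lie_bracket.
- exact: (Clambda k.+1).2.
- apply: Ck_onD => //; first exact: Ck_on_coad.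
  by apply: Ck_onN => //; exact: Ck_on_coad.
Qed.

(** The boundary term of the integration by parts; it vanishes wherever [zeta] does. *)
Let boundary t := pairing (p t) (eta t) + pairing (lambda t) (q t).

(** Pointwise integration by parts: the derivatives of [eta] and [lambda] are absorbed into that of
    [boundary], and duality with antisymmetry rearranges the bracket terms. *)
Lemma derive_reduced_variation t : O t ->
  'D_(reduced_variation c gamma zeta t) E (gamma t) = 'D_1 boundary t -
  (pairing (residual_xi t) (eta t) + pairing (lambda t) (residual_nu t)).
Proof.
move=> Ot; have dE : differentiable E (gamma t) by exact: (CE 1).1.
have dp := (Cp 1).1 _ Ot; have dq := (Cq 1).1 _ Ot.
have deta := (Ceta 1).1 _ Ot; have dlambda := (Clambda 1).1 _ Ot.
have -> : 'D_1 boundary t =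
    pairing ('D_1 p t) (eta t) + pairing (p t) ('D_1 eta t) +
    (pairing ('D_1 lambda t) (q t) + pairing (lambda t) ('D_1 q t)).
  rewrite -(derive_pairing _ dp deta) -(derive_pairing _ dlambda dq).
  have d1 := (Ck_on_pairing oO (Cp 1) (Ceta 1)).1 _ Ot.
  have d2 := (Ck_on_pairing oO (Clambda 1) (Cq 1)).1 _ Ot.
  by rewrite -deriveD//; exact: diff_derivable.
rewrite /reduced_variation derive1_fst_snd// derive_dE//= -/(p t) -/(q t).
exact: (@reduced_variation_identity _ _ (lie_bracket c) (coad c) (xi t)
  (eta t) ('D_1 eta t) (q t) ('D_1 q t) (nu t) (lambda t) ('D_1 lambda t)
  (p t) ('D_1 p t) (lie_bracketC hc1) (pairing_coad hc hc1)).
Qed.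

(** First variation formula: the result depends on [Gamma] only through [zeta], because the
    derivative at 0 sees only the reduced variation. *)
Lemma is_derive_action Gamma : zeta a = 0 -> zeta b = 0 ->
  reduced_deformation c a b gamma zeta Gamma ->
  is_derive (0 : R) 1 (fun e => action E a b (fun t => Gamma (e, t)))
    (- \int[lebesgue_measure]_(t in `[a, b])
        (pairing (residual_xi t) (eta t) + pairing (lambda t) (residual_nu t))).
Proof.
move=> za zb [[d d0 [P [oP dP CGamma]]] Gamma0 dGamma].
have Ch := Ck_on_comp_prod_mx oP (fun _ _ => I) CGamma CE.
apply: is_derive_eq (is_derive_Rintegral d0 oP dP (Ch 1%N)) _.
have P0 t : `[a, b]%classic t -> P (0, t).
  by move=> tab; apply: dP; split=> //=; rewrite in_itv/= oppr_lt0 d0.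
transitivity (\int[lebesgue_measure]_(t in `[a, b]) ('D_1 boundary t -
   (pairing (residual_xi t) (eta t) + pairing (lambda t) (residual_nu t)))).
  apply: eq_Rintegral => t /set_mem tab; have Ot := abO tab.
  have dG : differentiable Gamma (0, t) by exact: (CGamma 1%N).1 _ (P0 _ tab).
  have dE : differentiable E (Gamma (0, t)) by exact: (CE 1%N).1.
  (* By the chain rule, the derivative of E(Gamma(e, t)) at e = 0 is that of [E] in the direction of
     the reduced variation. *)
  rewrite -derive_reduced_variation// -/(gamma t) -dGamma// -Gamma0//.
  rewrite derive1E derive_pairl deriveE; last first.
    exact: (@differentiable_comp _ _ _ _ Gamma E).
  by rewrite (diff_comp dG dE) /= -(deriveE _ dG) -(deriveE _ dE).
have Cb : Ck_on 1 O boundary.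
  by apply: Ck_onD => //; exact: Ck_on_pairing.
have Cr : Ck_on 0 O (fun t =>
    pairing (residual_xi t) (eta t) + pairing (lambda t) (residual_nu t)).
  apply: Ck_onD => //; apply: Ck_on_pairing => //.
    exact: Ck_on_residual_xi.
  exact: Ck_on_residual_nu.
rewrite RintegralB//; last 2 first.
- exact: Ck_on0_integrable abO (Cb.2 1).
- exact: Ck_on0_integrable abO Cr.
(* The total derivative integrates to the difference of [boundary] at the end points, where [zeta]
   is 0. *)
rewrite (Rintegral_derive ab oO abO Cb) /boundary /eta /lambda za zb /=.
by rewrite !pairingE !big1 ?subrr ?sub0r// => i _; rewrite !mxE ?mul0r ?mulr0.
Qed.

End variation.

End first_variation.

(** * Passage to the end points, a realising deformation, and the equivalence *)

(** At an end point the value is the one-sided limit from the inside, where [f] is 0. *)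
Lemma Ck_on0_eq0_itvcc (R : realType) (V : normedModType R) (a b : R)
    (O : set R) (f : R -> V) : a < b -> `[a, b] `<=` O -> Ck_on 0 O f ->
  (forall t, `]a, b[%classic t -> f t = 0) ->
  forall t, `[a, b]%classic t -> f t = 0.
Proof.
move=> ab abO cf f0 t tab; have ct := cf _ (abO _ tab).
have aab : `[a, b]%classic a by rewrite /= bound_itvE ltW.
have bab : `[a, b]%classic b by rewrite /= bound_itvE ltW.
move: (tab); rewrite /= in_itv/= => /andP[].
rewrite le_eqVlt => /predU1P[<- _|at_].
  have cfa : f x @[x --> a^'+] --> f a.
    by apply: cvg_at_right_filter; exact: (cf _ (abO _ aab)).
  apply: (cvg_unique _ cfa) => //; apply: cvg_near_cst; near=> x.
  by apply: f0; rewrite /= in_itv/=; apply/andP; split; near: x;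
    [exact: nbhs_right_gt|exact: nbhs_right_lt].
rewrite le_eqVlt => /predU1P[->|tb].
  have cfb : f x @[x --> b^'-] --> f b.
    by apply: cvg_at_left_filter; exact: (cf _ (abO _ bab)).
  apply: (cvg_unique _ cfb) => //; apply: cvg_near_cst; near=> x.
  by apply: f0; rewrite /= in_itv/=; apply/andP; split; near: x;
    [exact: nbhs_left_gt|exact: nbhs_left_lt].
by apply: f0; rewrite /= in_itv/= at_.
Unshelve. all: by end_near. Qed.

(** The deformation is affine in the parameter, with the reduced variation as slope. *)
Lemma linear_deformation (R : realType) n (G : lieGroup R n)
    (c : chart G 'rV[R]_n) (a b : R) (O : set R)
    (gamma zeta : R -> 'rV[R]_n * 'cV[R]_n) : open O -> `[a, b] `<=` O ->
  (forall k, Ck_on k O gamma) ->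
  (forall k, Ck_on k O (reduced_variation c gamma zeta)) ->
  reduced_deformation c a b gamma zeta
    (fun p => gamma p.2 + p.1 *: reduced_variation c gamma zeta p.2).
Proof.
move=> oO abO Cg; set rv := reduced_variation _ _ _ => Crv; split.
(* Smoothness holds for all parameter values, on R times [O], so the radius 1 is an arbitrary
   choice. *)
- exists 1 => //; exists (snd @^-1` O).
  have csnd : continuous (snd : R * R -> R) by move=> x; exact: cvg_snd.
  have cfst : continuous (fst : R * R -> R) by move=> x; exact: cvg_fst.
  have oO2 : open (snd @^-1` O : set (R * R)) by exact: open_comp.
  split=> // [p [_ /abO]//|k].
  have Csnd (V : normedModType R) (f : R -> V) :
      Ck_on k O f -> Ck_on k (snd @^-1` O : set (R * R)) (fun p => f p.2).
    exact: Ck_on_comp_linear.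
  have Cfst : Ck_on k (snd @^-1` O : set (R * R)) (fst : R * R -> R).
    apply: (@Ck_on_linear_comp _ _ _ _ k _ fst (fun p : R * R => p)) => //.
    exact: Ck_on_id.
  apply: Ck_onD => //; first exact: Csnd.
  (* Scaling is split into components, since [Ck_on_scale] is about matrices and not about pairs. *)
  apply: (@Ck_on_ext _ _ _ k _
    (fun p : R * R => (p.1 *: (rv p.2).1, p.1 *: (rv p.2).2))) => //.
  apply: Ck_on_pair => //; apply: Ck_on_scale => //.
  + apply: (@Csnd _ (fun t => (rv t).1)).
    by apply: (@Ck_on_linear_comp _ _ _ _ k O fst rv) => // x; exact: cvg_fst.
  + apply: (@Csnd _ (fun t => (rv t).2)).
    by apply: (@Ck_on_linear_comp _ _ _ _ k O snd rv) => // x; exact: cvg_snd.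
- by move=> t _ /=; rewrite scale0r addr0.
- move=> t _ /=; rewrite derive1E.
  have ds : differentiable (fun e : R => e *: rv t) 0 by exact: ex_diff.
  rewrite deriveD; [|exact: derivable_cst|exact: diff_derivable].
  by rewrite derive_cst add0r deriveE// diff_val scale1r.
Qed.

Theorem proposition6p24 (R : realType) (n : nat) (G : lieGroup R n)
    (c : chart G 'rV[R]_n) (hc : lie_atlas c) (hc1 : chart_dom c 1%g)
    (E : 'rV[R]_n * 'cV[R]_n -> R) (hE : smooth_on setT E)
    (a b : R) (hab : a < b)
    (xi : R -> 'rV[R]_n) (nu : R -> 'cV[R]_n)
    (hxi : smooth_on `[a, b] xi) (hnu : smooth_on `[a, b] nu) :
  reduced_extremal c E a b (fun t => (xi t, nu t)) <->
  (forall t, t \in `[a, b] ->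
     is_derive t 1 (fun s => dE_dxi E (xi s, nu s))
       (coad c (xi t) (dE_dxi E (xi t, nu t))
        - coad c (dE_dnu E (xi t, nu t)) (nu t)) /\
     is_derive t 1 (fun s => dE_dnu E (xi s, nu s))
       (- lie_bracket c (xi t) (dE_dnu E (xi t, nu t)))).
Proof.
have CE k : Ck_on k setT E.
  by have [P [_ TP CP]] := hE; exact: Ck_on_sub TP (CP k).
have [U [openU abU CU]] := hxi; have [V [openV abV CV]] := hnu.
pose W := U `&` V; have openW : open W by exact: openI.
have abW : `[a, b] `<=` W by move=> t tab; split; [exact: abU|exact: abV].
have Cxi k : Ck_on k W xi by apply: Ck_on_sub (CU k) => t [].
have Cnu k : Ck_on k W nu by apply: Ck_on_sub (CV k) => t [].
have Cg k : Ck_on k W (fun t => (xi t, nu t)) by exact: Ck_on_pair.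
split=> [extremal|EL].
- pose r1 := residual_xi c E xi nu; pose r2 := residual_nu c E xi nu.
  have Cr1 k : Ck_on k W r1 by exact: Ck_on_residual_xi.
  have Cr2 k : Ck_on k W r2 by exact: Ck_on_residual_nu.
  (* The weight makes [zeta] vanish at both ends and is positive in between. *)
  pose phi (t : R) : R := (t - a) * (b - t).
  have Cphi k : Ck_on k W phi.
    apply: Ck_onM => //; apply: Ck_onD => //;
      [exact: Ck_on_id|exact: Ck_on_cst..|].
    by apply: Ck_onN => //; exact: Ck_on_id.
  have phi_ge0 t : `[a, b]%classic t -> 0 <= phi t.
    by rewrite /= in_itv/= => /andP[? ?]; rewrite mulr_ge0// subr_ge0.
  have phi_gt0 t : `]a, b[%classic t -> 0 < phi t.
    by rewrite /= in_itv/= => /andP[? ?]; rewrite mulr_gt0// subr_gt0.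
  (* Transposition exchanges g and its dual in coordinates, so that the pairings with the residuals
     become sums of squares. *)
  pose zeta t := (phi t *: (r1 t)^T, phi t *: (r2 t)^T).
  have Cz k : Ck_on k W zeta.
    by apply: Ck_on_pair => //; apply: Ck_on_scale => //; exact: Ck_on_trmx.
  have za : zeta a = 0 by rewrite /zeta /phi subrr mul0r !scale0r.
  have zb : zeta b = 0 by rewrite /zeta /phi subrr mulr0 !scale0r.
  have def := linear_deformation openW abW Cg
    (Ck_on_reduced_variation hc hc1 openW Cxi Cnu Cz).
  have smooth_zeta : smooth_on `[a, b] zeta by exists W.
  (* Extremality makes the derivative of the action 0, the first variation formula makes it minus
     the integral; hence the integral is 0. *)
  have [_ D0] := extremal _ _ smooth_zeta za zb def.
  have [_] := is_derive_action hc hc1 CE hab openW abW Cxi Cnu Cz za zb def.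
  rewrite D0 => /esym/eqP; rewrite oppr_eq0 => /eqP I0.
  pose sq t := pairing (r1 t) (r1 t)^T + pairing (r2 t)^T (r2 t).
  have sq_ge0 t : 0 <= sq t.
    by apply: addr_ge0; [exact: pairing_tr_ge0|exact: pairing_trl_ge0].
  have Csq k : Ck_on k W (fun t => phi t * sq t).
    apply: Ck_onM => //; apply: Ck_onD => //; apply: Ck_on_pairing => //;
    exact: Ck_on_trmx.
  have I0' : \int[lebesgue_measure]_(t in `[a, b]) (phi t * sq t) = 0.
    rewrite -[RHS]I0; apply: eq_Rintegral => t _ /=.
    by rewrite pairingZr pairingZl -mulrDr.
  have r0 t : `]a, b[%classic t -> r1 t = 0 /\ r2 t = 0.
    move=> tab.
    have /eqP := Rintegral_ge0_eq0 openW abW (Csq 0%N)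
      (fun t tab => mulr_ge0 (phi_ge0 t tab) (sq_ge0 t)) I0' tab.
    rewrite mulf_eq0 (gt_eqF (phi_gt0 _ tab))/= /sq.
    rewrite (paddr_eq0 (pairing_tr_ge0 _) (pairing_trl_ge0 _)).
    by move=> /andP[/eqP/pairing_tr_eq0 ? /eqP/pairing_trl_eq0].
  move=> t tab.
  (* The weight vanishes at the ends, so the residuals are 0 there only by continuity. *)
  have r1t := Ck_on0_eq0_itvcc hab abW (Cr1 0%N)
    (fun t tab => (r0 t tab).1) tab.
  have r2t := Ck_on0_eq0_itvcc hab abW (Cr2 0%N)
    (fun t tab => (r0 t tab).2) tab.
  have Wt := abW _ tab.
  (* Derivability comes from the smoothness of the gradients along the curve, the derivatives
     themselves from the vanishing residuals. *)
  split; apply: DeriveDef.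
  + by apply: diff_derivable; exact: (Ck_on_dE_dxi CE openW Cg 1).1.
  + by apply/eqP; rewrite -subr_eq0; apply/eqP.
  + by apply: diff_derivable; exact: (Ck_on_dE_dnu CE openW Cg 1).1.
  + by apply/eqP; rewrite -subr_eq0 opprK; apply/eqP.
- move=> zeta Gamma [Z [openZ abZ CZ]] za zb def.
  (* An arbitrary [zeta] brings its own neighbourhood [Z], so everything is restricted to a common
     one. *)
  have openWZ : open (W `&` Z) by exact: openI.
  have abWZ : `[a, b] `<=` W `&` Z.
    by move=> t tab; split; [exact: abW|exact: abZ].
  have Cxi' k : Ck_on k (W `&` Z) xi by apply: Ck_on_sub (Cxi k) => t [].
  have Cnu' k : Ck_on k (W `&` Z) nu by apply: Ck_on_sub (Cnu k) => t [].
  have CZ' k : Ck_on k (W `&` Z) zeta by apply: Ck_on_sub (CZ k) => t [].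
  apply: is_derive_eq (is_derive_action hc hc1 CE hab openWZ abWZ Cxi' Cnu' CZ'
    za zb def) _.
  rewrite (@eq_Rintegral _ _ _ _ _ (fun=> 0)) ?Rintegral_cst ?mul0r ?oppr0//.
  (* The equations make both residuals 0 on the segment, and with them the integrand. *)
  move=> t /set_mem tab; have [[_ e1] [_ e2]] := EL t tab.
  rewrite /residual_xi /residual_nu e1 e2 subrr addNr /pairing.
  by rewrite mulmx0 mul0mx !mxE addr0.
Qed.
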